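(* Let $(G,\tau)$ be an infinite Hausdorff saturated paratopological group. Then there does not exist a Hausdorff paratopological group topology $\sigma$ on $G$ such that $\sigma$ and $\tau$ are $T_1$-complementary. In particular, the Sorgenfrey line $\mathbb{S}$ does not admit a $T_1$-complementary Hausdorff paratopological group topology, i.e. there is no Hausdorff paratopological group topology $\sigma$ on the additive group $\mathbb{R}$ such that $\sigma$ and the Sorgenfrey topology are $T_1$-complementary.
   Context: A paratopological group is a group with a topology for which multiplication is jointly continuous; such a topology is called a paratopological group topology. A paratopological group is saturated if for every neighborhood $U$ of the identity the set $U^{-1}$ has nonempty interior. Two $T_1$ topologies $\tau_1,\tau_2$ on a set $X$ are $T_1$-complementary if $\tau_1\cap\tau_2$ is the cofinite topology on $X$ and the topology generated by $\tau_1\cup\tau_2$ is discrete. The Sorgenfrey line $\mathbb{S}$ is the additive group $\mathbb{R}$ with the topology whose base consists of the half-open intervals $[a,b)$, $a<b$. *)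

(* Defs.v *)
From HB Require Import structures.
From mathcomp Require Import all_boot all_order all_algebra.
From mathcomp Require Import all_classical all_reals all_analysis.

Set Implicit Arguments.
Unset Strict Implicit.
Unset Printing Implicit Defensive.

Import Order.TTheory GRing.Theory Num.Theory.

Local Open Scope classical_set_scope.

(* Several topologies on one carrier T are handled as elements of
   [Topological T], as the library does for [sup_topology]; [topo_space tau]
   is T equipped with the topology tau. *)
Notation topo_space tau := (Topological.Pack tau).

Definition paratopological_group (G : groupType) (tau : Topological G) : Prop :=
  continuous (fun p : topo_space tau * topo_space tau =>
    ((p.1 : G) * (p.2 : G))%g : topo_space tau).

Definition saturated (G : groupType) (tau : Topological G) : Prop :=
  forall U : set G, nbhs (1%g : topo_space tau) U ->
    interior ([set (x^-1)%g | x in U] : set (topo_space tau)) !=set0.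

(* [set0] is added because its complement need not be finite. *)
Definition cofinite_topology (X : Type) : set (set X) :=
  [set A | A = set0 \/ cofinite_set A].

Definition T1_complementary (X : choiceType) (tau1 tau2 : Topological X) :
    Prop :=
  [/\ accessible_space (topo_space tau1),
      accessible_space (topo_space tau2),
      @open (topo_space tau1) `&` @open (topo_space tau2) = @cofinite_topology X &
      forall A : set (sup_topology (fun b : bool => if b then tau1 else tau2)),
        open A].

Section Sorgenfrey.
Context {R : realType}.
Local Open Scope ring_scope.

(* An alias, since R itself carries its usual topology. *)
Definition sorgenfrey_line : Type := R.

HB.instance Definition _ := Choice.on sorgenfrey_line.

Definition sorgenfrey_base : set (set sorgenfrey_line) :=
  [set A | exists a b : R, a < b /\ A = [set` `[a, b[]].

Let base_cover : \bigcup_(A in sorgenfrey_base) id A = setT.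
Proof.
apply/seteqP; split => // x _; exists [set` `[(x : R), (x : R) + 1[].
  by exists (x : R), ((x : R) + 1); rewrite ltrDl.
by rewrite /= in_itv /= lexx ltrDl ltr01.
Qed.

Let base_join A B t : sorgenfrey_base A -> sorgenfrey_base B ->
  id A t -> id B t ->
  exists C, [/\ sorgenfrey_base C, id C t & id C `<=` id A `&` id B].
Proof.
move=> [a1 [a2 [_ ->]]] [c1 [c2 [_ ->]]] /=.
rewrite !in_itv /= => /andP[a1t ta2] /andP[c1t tc2].
exists [set` `[Num.max a1 c1, Num.min a2 c2[]; split => /=.
- exists (Num.max a1 c1), (Num.min a2 c2); split => //.
  by rewrite (@le_lt_trans _ _ (t : R)) // ?ge_max ?lt_min ?a1t ?c1t ?ta2.
- by rewrite in_itv /= ge_max lt_min a1t c1t ta2.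
- move=> x /=; rewrite !in_itv /= ge_max lt_min.
  by move=> /andP[/andP[-> ->] /andP[-> ->]].
Qed.

HB.instance Definition _ :=
  isBaseTopological.Build sorgenfrey_line base_cover base_join.

End Sorgenfrey.

Arguments sorgenfrey_line : clear implicits.

(* [to_multiplicative R] is the additive group of R seen as a groupType. *)
Definition sorgenfrey_topology (R : realType) :
    Topological (Algebra.to_multiplicative R) :=
  Topological.class (sorgenfrey_line R).

(* Main.v *)
(** In a paratopological group the product [D V] of a τ-open [D] and a σ-open
    [V] is open for both topologies, so it is cofinite when nonempty.
    Discreteness of the join gives open neighbourhoods [U], [V] of 1 with
    [U ∩ V = {1}].  If τ is not discrete, pick [x] in [U \ {1}] and a
    neighbourhood [W] of 1 with [W W x ⊆ U \ {1}]; by saturation [W^-1] has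
    nonempty interior [D], so [D^-1 W x] misses [V], hence [D V] misses the
    infinite set [W x] and is not cofinite.  If τ is discrete, every σ-open set
    is cofinite or empty, so σ is not Hausdorff. *)
Require Import Defs.
From HB Require Import structures.
From mathcomp Require Import all_boot all_order all_algebra.
From mathcomp Require Import all_classical all_reals all_analysis.

Set Implicit Arguments.
Unset Strict Implicit.
Unset Printing Implicit Defensive.

Local Open Scope classical_set_scope.

Import Order.TTheory GRing.Theory Num.Theory.

(** In a T1 space the finite set [A \ x] is closed; removing it from [A] leaves the open set
    [[set x]]. *)
Lemma open_finite_isolated (T : topologicalType) (A : set T) (x : T) :
  accessible_space T -> open A -> finite_set A -> A x -> open [set x].
Proof.
move=> /accessible_finite_set_closed T1 oA finA Ax.
suff -> : [set x] = A `&` ~` (A `\ x).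
  apply: openI => //; apply: closed_openC; apply: T1.
  by apply: sub_finite_set finA => y [].
apply/seteqP; split=> [y ->|y [Ay]]; first by split=> // -[_ /(_ erefl)].
by move=> /not_andP[//|/contrapT].
Qed.

(** The sets containing such an intersection [U ∩ V] form a filter [F] that converges to [x] in each
    topology, hence in their join, so [F] contains every join neighbourhood of [x]. *)
Lemma nbhs_sup2 (T : choiceType) (tau1 tau2 : Topological T) (x : T)
    (A : set T) :
  nbhs (x : sup_topology (fun b : bool => if b then tau1 else tau2)) A ->
  exists U V, [/\ open (U : set (topo_space tau1)),
    open (V : set (topo_space tau2)), U x, V x & U `&` V `<=` A].
Proof.
pose F : set_system T := [set B | exists U V,
  [/\ nbhs (x : topo_space tau1) U, nbhs (x : topo_space tau2) V &
      U `&` V `<=` B]].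
have FF : Filter F.
  split.
  - by exists setT, setT; split=> //; exact: filterT.
  - move=> P Q [U1 [V1 [xU1 xV1 sP]]] [U2 [V2 [xU2 xV2 sQ]]].
    exists (U1 `&` U2), (V1 `&` V2); split; [exact: filterI|exact: filterI|].
    by move=> y [[? ?] [? ?]]; split; [exact: sP|exact: sQ].
  - move=> P Q PQ [U [V [xU xV sP]]]; exists U, V; split=> //.
    exact: subset_trans PQ.
move=> xA; have : F A.
  have /cvg_sup : forall b : bool,
      F --> (x : topo_space (if b then tau1 else tau2)).
    move=> [] B xB.
      by exists B, setT; split; [exact: xB|exact: filterT|move=> y []].
    by exists setT, B; split; [exact: filterT|exact: xB|move=> y []].
  exact.
move=> [U [V [xU xV sA]]].
exists (interior (U : set (topo_space tau1))).
exists (interior (V : set (topo_space tau2))); split => //.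
- exact: open_interior.
- exact: open_interior.
- move=> y [yU yV]; apply: sA; split; first exact: interior_subset yU.
  exact: interior_subset yV.
Qed.

Section ParatopologicalGroup.
Variables (G : groupType) (tau : Topological G).
Hypothesis ptau : paratopological_group tau.
Implicit Types (A B : set G) (x y : G).

Lemma nbhs_mulg x y A : nbhs ((x * y)%g : topo_space tau) A ->
  exists U V, [/\ nbhs (x : topo_space tau) U, nbhs (y : topo_space tau) V &
    forall u v, U u -> V v -> A (u * v)%g].
Proof.
move=> /(@ptau (x, y))[[U V] [xU yV] sA]; exists U, V; split=> // u v Uu Vv.
exact: (sA (u, v)).
Qed.

Lemma open_translatel x A : open (A : set (topo_space tau)) ->
  open ([set y | A (x * y)%g] : set (topo_space tau)).
Proof.
rewrite !openE => oA y /oA /nbhs_mulg[U [V [/nbhs_singleton Ux yV UV]]].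
by apply: filterS yV => z Vz; exact: UV.
Qed.

Lemma open_translater x A : open (A : set (topo_space tau)) ->
  open ([set y | A (y * x)%g] : set (topo_space tau)).
Proof.
rewrite !openE => oA y /oA /nbhs_mulg[U [V [yU /nbhs_singleton Vx UV]]].
by apply: filterS yU => z Uz; exact: UV.
Qed.

(** The product is a union of right translates of [A], each a preimage under a translation. As [B]
    is arbitrary, this and its mirror image make one product open for two topologies. *)
Lemma open_mulgl A B : open (A : set (topo_space tau)) ->
  open ([set (a * b)%g | a in A & b in B] : set (topo_space tau)).
Proof.
move=> oA.
suff -> : [set (a * b)%g | a in A & b in B] =
    \bigcup_(b in B) [set z | A (z * b^-1)%g].
  by apply: (@bigcup_open (topo_space tau)) => b _; exact: open_translater.
apply/seteqP; split=> [_ [a Aa [b Bb <-]]|z [b Bb Az]].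
  by exists b => //=; rewrite mulgK.
by exists (z * b^-1)%g => //; exists b; rewrite // mulgVK.
Qed.

Lemma open_mulgr A B : open (B : set (topo_space tau)) ->
  open ([set (a * b)%g | a in A & b in B] : set (topo_space tau)).
Proof.
move=> oB.
suff -> : [set (a * b)%g | a in A & b in B] =
    \bigcup_(a in A) [set z | B (a^-1 * z)%g].
  by apply: (@bigcup_open (topo_space tau)) => a _; exact: open_translatel.
apply/seteqP; split=> [_ [a Aa [b Bb <-]]|z [a Aa Bz]].
  by exists a => //=; rewrite mulKg.
by exists a => //; exists (a^-1 * z)%g; rewrite // mulVKg.
Qed.

(** Any [A] is the product of the open set [{x}] and [x^-1 A]. *)
Lemma open_set1_discrete x A : open ([set x] : set (topo_space tau)) ->
  open (A : set (topo_space tau)).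
Proof.
move=> ox; suff -> : A = [set (a * b)%g | a in [set x] & b in
    [set (x^-1 * y)%g | y in A]] by exact: open_mulgl.
apply/seteqP; split=> [y Ay|_ [_ -> [_ [y Ay <-] <-]]]; last by rewrite mulVKg.
by exists x => //; exists (x^-1 * y)%g; [exists y|rewrite mulVKg].
Qed.

End ParatopologicalGroup.

Lemma cofinite_not_hausdorff (T : topologicalType) : infinite_set [set: T] ->
  @open T `<=` @cofinite_topology T -> ~ hausdorff_space T.
Proof.
move=> infT cofT hT.
have [x _] : [set: T] !=set0.
  by apply/set0P/eqP => T0; apply: infT; rewrite T0.
have [y /eqP xy] : exists y, y <> x.
  apply: contrapT => /forallNP Tx; apply: infT.
  apply: (sub_finite_set _ (finite_set1 x)) => y _.
  exact: contrapT (Tx y).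
move: hT; rewrite open_hausdorff => /(_ _ _ xy)[[A B] /= [yA xB]].
rewrite !inE in yA xB => -[/cofT oA /cofT oB /eqP AB0].
case: oA yA => [->//|cA] _; case: oB xB => [->//|cB] _.
(* Disjointness makes the whole space the union of two finite complements. *)
apply: infT; rewrite -setC0 -AB0 setCI.
by rewrite finite_setU.
Qed.

Lemma saturated_no_complementary (G : groupType) (tau sigma : Topological G) :
  infinite_set [set: G] -> paratopological_group tau -> saturated tau ->
  hausdorff_space (topo_space sigma) -> paratopological_group sigma ->
  ~ T1_complementary sigma tau.
Proof.
move=> infG ptau stau hsigma psigma [_ T1tau cofE discr].
have cofP A : open (A : set (topo_space sigma)) ->
    open (A : set (topo_space tau)) -> @cofinite_topology G A.
  by move=> osA otA; rewrite -cofE.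
have ndiscr x : ~ open ([set x] : set (topo_space tau)).
  move=> ox; apply: (@cofinite_not_hausdorff (topo_space sigma)) => // A oA.
  exact/cofP/open_set1_discrete/ox.
(* A finite nonempty open set would contain an open singleton, excluded by [ndiscr]. *)
have infopen A x : open (A : set (topo_space tau)) -> A x -> infinite_set A.
  by move=> oA Ax fA; exact: ndiscr (open_finite_isolated T1tau oA fA Ax).
have [V [U [oV oU V1 U1 UV1]]] : exists V U,
    [/\ open (V : set (topo_space sigma)), open (U : set (topo_space tau)),
        V 1%g, U 1%g & V `&` U `<=` [set 1%g]].
  by apply: nbhs_sup2; apply: open_nbhs_nbhs; split => //; exact: discr.
have [x [Ux x1]] : exists x, U x /\ x <> 1%g.
  apply: contrapT => /forallNP Ux; apply: (infopen _ _ oU U1).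
  apply: (sub_finite_set _ (finite_set1 1%g)) => y Uy.
  by apply: contrapT => y1; exact: (Ux y).
have oU' : open (U `\ 1%g : set (topo_space tau)).
  rewrite setDE; apply: openI => //; apply: closed_openC.
  exact: accessible_closed_set1.
(* Continuity of multiplication at [(1, 1)], applied to the translate [(U \ {1}) x^-1], which
   contains 1 because [x] lies in [U \ {1}]. *)
have [W [oW W1 WWx]] : exists W, [/\ open (W : set (topo_space tau)), W 1%g &
    forall a b, W a -> W b -> (U `\ 1%g) (a * (b * x))%g].
  have : nbhs (1 * 1 : topo_space tau)%g [set y | (U `\ 1%g) (y * x)%g].
    apply: open_nbhs_nbhs; split; first exact: open_translater.
    by rewrite /= !mul1g.
  move=> /(nbhs_mulg ptau)[W1 [W2 [nW1 nW2 W12]]].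
  exists (interior (W1 `&` W2 : set (topo_space tau))); split.
  - exact: open_interior.
  - exact: filterI.
  - move=> a b /interior_subset[W1a _] /interior_subset[_ W2b].
    by rewrite mulgA; exact: W12.
have [d Dd] := stau _ (open_nbhs_nbhs (conj oW W1)).
set D := interior _ in Dd.
have DW c : D c -> W (c^-1)%g.
  by move=> /interior_subset[w Ww <-]; rewrite invgK.
have [DV0|] : @cofinite_topology G [set (c * v)%g | c in D & v in V].
- apply: cofP; first exact: open_mulgr.
  by apply: open_mulgl => //; exact: open_interior.
- suff : set0 (d * 1)%g by [].
  by rewrite -DV0; exists d => //; exists 1%g.
(* This set is [W x]; it remains to place it in the finite complement of [D V]. *)
move=> fin; have : infinite_set [set y | W (y * x^-1)%g].
  by apply: (infopen _ x); [exact: open_translater|rewrite /= mulgV].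
apply; apply: sub_finite_set fin => y Wy [c Dc [v Vv cvy]].
(* From [y = c v] one gets [v = c^-1 y] in [W W x], so [v] lies in [U \ {1}]; but [v] is also in
   [V], which forces [v = 1]. *)
have /(WWx _ _ (DW _ Dc))[] := Wy.
rewrite mulgVK -cvy mulKg => Uv; apply.
exact: UV1.
Qed.

Section Sorgenfrey.
Variable R : realType.
Local Open Scope ring_scope.

Lemma sorgenfrey_open_itv (a b : R) : a < b ->
  open ([set` `[a, b[] : set (sorgenfrey_line R)).
Proof.
move=> ab; exists [set [set` `[a, b[]]; last by rewrite bigcup_set1.
by move=> _ ->; exists a, b.
Qed.

Lemma nbhs_sorgenfrey (x : R) (A : set R) :
  nbhs (x : sorgenfrey_line R) A <->
  exists2 e : R, 0 < e & [set` `[x, x + e[] `<=` A.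
Proof.
split=> [|[e e0 sA]].
  rewrite nbhsE => -[_ [[D sD <-] [B DB Bx]] sA].
  have [a [b [ab BE]]] := sD _ DB.
  move: (Bx); rewrite BE /= in_itv /= => /andP[ax xb].
  (* The basic set [[a, b[] around [x] is cut on the left to [[x, b[]. *)
  exists (b - x); first by rewrite subr_gt0.
  move=> y /=; rewrite in_itv /= subrKC => /andP[xy yb].
  by apply: sA; exists B => //; rewrite BE /= in_itv /= (le_trans ax xy).
apply: filterS sA _; apply: open_nbhs_nbhs; split.
  by apply: sorgenfrey_open_itv; rewrite ltrDl.
by rewrite /= in_itv /= lexx ltrDl.
Qed.

Lemma sorgenfrey_paratopological :
  paratopological_group (sorgenfrey_topology R).
Proof.
move=> [x y] A /nbhs_sorgenfrey[e e0 sA].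
have e20 : 0 < e / 2 by rewrite divr_gt0.
exists ([set` `[x : R, (x : R) + e / 2[], [set` `[y : R, (y : R) + e / 2[]).
  by split; apply/nbhs_sorgenfrey; exists (e / 2).
move=> [u v] [/=]; rewrite !in_itv /= => /andP[xu ux] /andP[yv vy].
apply: sA; rewrite /= in_itv /=; apply/andP; split; first exact: lerD.
by rewrite [e]splitr addrACA ltrD.
Qed.

(** If [U] contains [[0, e[], then [-U] contains []-e, 0]], and hence the neighbourhood [[-e/2, 0[]
    of [-e/2]. *)
Lemma sorgenfrey_saturated : saturated (sorgenfrey_topology R).
Proof.
move=> U /nbhs_sorgenfrey[e e0 sU].
exists (- (e / 2) : R); apply/nbhs_sorgenfrey; exists (e / 2).
  by rewrite divr_gt0.
move=> x /=; rewrite in_itv /= addNr => /andP[ex x0].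
exists (- x : R); last exact: opprK.
apply: sU; rewrite /= in_itv /= add0r oppr_ge0 (ltW x0) /= ltrNl.
by apply: lt_le_trans ex; rewrite ltrN2 ltr_pdivrMr // ltr_pMr // ltr1n.
Qed.

End Sorgenfrey.

(** The naturals embed injectively, the characteristic being zero. *)
Lemma infinite_numDomain (R : numDomainType) : infinite_set [set: R].
Proof.
move=> finR; apply: infinite_nat.
rewrite -(preimage_setT (fun n : nat => n%:R%R : R)).
apply: finite_preimage finR => m n _ _ /eqP.
by rewrite eqr_nat => /eqP.
Qed.

Theorem corollary3p4 :
  (forall (G : groupType) (tau : Topological G),
     infinite_set [set: G] ->
     hausdorff_space (topo_space tau) ->
     paratopological_group tau ->
     saturated tau ->
     ~ exists sigma : Topological G,
         [/\ hausdorff_space (topo_space sigma),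
             paratopological_group sigma &
             T1_complementary sigma tau])
  /\
  (forall R : realType,
     ~ exists sigma : Topological (Algebra.to_multiplicative R),
         [/\ hausdorff_space (topo_space sigma),
             paratopological_group sigma &
             T1_complementary sigma (sorgenfrey_topology R)]).
Proof.
split=> [G tau infG _ ptau stau|R] [sigma [hsigma psigma]].
  exact: saturated_no_complementary.
apply: saturated_no_complementary hsigma psigma.
- exact: infinite_numDomain.
- exact: sorgenfrey_paratopological.
- exact: sorgenfrey_saturated.
Qed.
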